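(* Let $k \geq 2$ and $r = \lceil \frac{k-1}{2} \rceil$. There is a constant $c>0$ (depending on $k$) such that for all sufficiently large $n$ with $n \equiv 3 \pmod 4$, there exists an $n$-vertex tournament $T$ with $\delta^{0}(T) \geq \frac{n+1}{4} + c\cdot \frac{\mathrm{ex}(n,K_{r,r})}{n}$ which does not contain the $k$-th power of a Hamilton cycle.
   Context: A tournament is an orientation of a complete graph; $\delta^0(T)$ is the minimum over all vertices of their in- and out-degrees. $\mathrm{ex}(n,K_{r,r})$ is the maximum number of edges in an $n$-vertex (undirected) graph containing no copy of the complete bipartite graph $K_{r,r}$. The $k$-th power of a directed cycle $v_0v_1\ldots v_{l}v_0$ is the directed graph on its vertices with edges $v_iv_{i+j}$ for all $i$ and $1\le j\le k$ (indices mod $l+1$); containing the $k$-th power of a Hamilton cycle means containing such a subgraph through all vertices. *)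

(* Defs.v *)
From mathcomp Require Import all_boot all_order all_algebra.
From mathcomp Require Import reals.

Set Implicit Arguments.
Unset Strict Implicit.
Unset Printing Implicit Defensive.

(* A digraph on the vertex type V is a relation: e x y means x -> y. *)
Definition is_tournament (V : finType) (e : rel V) : Prop :=
  (forall x : V, ~~ e x x) /\ (forall x y : V, x != y -> e x y (+) e y x).

Definition outdeg (V : finType) (e : rel V) (x : V) : nat := #|[set y | e x y]|.
Definition indeg (V : finType) (e : rel V) (x : V) : nat := #|[set y | e y x]|.

(* Degrees never exceed #|V|, so the default value #|V| is inert unless V is
   empty. *)
Definition min_semidegree (V : finType) (e : rel V) : nat :=
  \big[minn/#|V|]_(x : V) minn (indeg e x) (outdeg e x).

(* The k-th power of the directed cycle 0 -> 1 -> ... -> m-1 -> 0. *)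
Definition cycle_power (m k : nat) : rel 'I_m :=
  fun a b => [exists j : 'I_k, nat_of_ord b == (a + j.+1) %% m].

Definition has_hamilton_cycle_power (k : nat) (V : finType) (e : rel V) : Prop :=
  exists v : 'I_#|V| -> V,
    bijective v /\ forall a b, cycle_power k a b -> e (v a) (v b).

(* A simple undirected graph on V is given by its edge set, a set of 2-subsets
   of V. *)
Definition is_graph (V : finType) (E : {set {set V}}) : bool :=
  [forall e in E, #|e| == 2].

Definition contains_copy (U V : finType) (F : {set {set U}}) (E : {set {set V}})
    : bool :=
  [exists f : {ffun U -> V}, injectiveb f && [forall e in F, f @: e \in E]].

Definition complete_bipartite (r s : nat) : {set {set 'I_r + 'I_s}} :=
  [set [set inl i; inr j] | i : 'I_r, j : 'I_s].

Definition ex_number (n : nat) (U : finType) (F : {set {set U}}) : nat :=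
  \max_(E : {set {set 'I_n}} | is_graph E && ~~ contains_copy F E) #|E|.

(* Main.v *)
Require Import Defs.
From mathcomp Require Import all_boot all_order all_algebra.
From mathcomp Require Import reals.
From mathcomp Require Import zify.

Set Implicit Arguments.
Unset Strict Implicit.
Unset Printing Implicit Defensive.

Import Order.TTheory GRing.Theory Num.Theory.

(* Write n = 4m + 3 and split the vertices into A, B of size 2m + 1 and one
   further vertex v.  Put regular tournaments inside A and B, orient B -> v -> A,
   and orient all edges from A to B except those of a bipartite K_{r,r}-free
   graph H.  In the k-th power of a Hamilton cycle the k vertices before v lie in
   B and the k vertices after v lie in A, so as 2r <= k the r closest ones on
   each side span a K_{r,r} in H, which is impossible.
   The semidegree is at least m + 1 + D when all degrees of H are at least D (and
   not too large).  To get such an H with D of order ex(n, K_{r,r}) / n, pass from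
   an extremal graph to a dense subgraph on about n / 8 vertices, then to one of
   large minimum degree; take disjoint copies of its bipartite double cover, and
   reach exactly 2m + 1 vertices per side by splitting some vertices in two, each
   part receiving half of the neighbours.  None of these operations creates a
   K_{r,r}. *)

(** * Biclique-free relations: locally injective maps, copies, vertex splitting *)

Definition degree (V : finType) (e : rel V) (x : V) : nat := #|[set y | e x y]|.

(** [x] and [y] may overlap: this excludes K_{r,r} with prescribed sides from the bipartite double
    cover of [e]. *)
Definition biclique_free (r : nat) (V : finType) (e : rel V) : Prop :=
  forall x y : 'I_r -> V, injective x -> injective y ->
    ~ (forall i j, e (x i) (y j)).

(** As [0 < r], the vertices on one side of a biclique share a neighbour on the other, so a locally
    injective homomorphism is injective on each side and carries bicliques to bicliques. *)
Lemma biclique_free_pullback (r : nat) (V W : finType) (e : rel V) (f : rel W)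
    (phi : V -> W) :
  0 < r -> symmetric e -> (forall a b, e a b -> f (phi a) (phi b)) ->
  (forall a a' b, e a b -> e a' b -> phi a = phi a' -> a = a') ->
  biclique_free r f -> biclique_free r e.
Proof.
case: r => // r _ esym ef loc_inj free_f x y inj_x inj_y exy.
apply: (free_f (phi \o x) (phi \o y)) => [i j /= Eij|i j /= Eij|i j]; last exact: ef.
- exact: (inj_x _ _ (loc_inj _ _ _ (exy i ord0) (exy j ord0) Eij)).
- apply: inj_y; apply: (loc_inj _ _ (x ord0)) Eij; by rewrite esym.
Qed.

Lemma disjoint_copies (r : nat) (W : finType) (f : rel W) (t : nat) :
  0 < r -> symmetric f -> biclique_free r f ->
  exists e : rel (W * 'I_t)%type,
    [/\ symmetric e, biclique_free r e & forall p, degree e p = degree f p.1].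
Proof.
move=> r0 fsym free_f; pose e (p q : W * 'I_t) := (p.2 == q.2) && f p.1 q.1.
have esym : symmetric e by move=> p q; rewrite /e eq_sym fsym.
exists e; split=> //.
- apply: (@biclique_free_pullback _ _ _ e f fst) => //.
    by move=> p q /andP[].
  by move=> [a i] [a' i'] b /andP[/eqP /= -> _] /andP[/eqP /= -> _] ->.
- move=> [a i]; rewrite /degree /= -(card_imset _ (f := fun y => (y, i))) //; last by move=> x y [].
  apply: eq_card => -[y j]; rewrite !inE /e /=; apply/andP/imsetP.
    by move=> [/eqP <- fay]; exists y; rewrite ?inE.
  by move=> [y']; rewrite inE => fay' [-> ->].
Qed.

Lemma exists_subset_card (V : finType) (A : {set V}) (s : nat) :
  s <= #|A| -> exists2 B : {set V}, B \subset A & #|B| = s.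
Proof.
move=> sA; exists [set x in take s (enum A)].
  by apply/subsetP=> x; rewrite inE => /mem_take; rewrite mem_enum.
by rewrite cardsE (card_uniqP _) ?take_uniq ?enum_uniq // size_takel // -cardE.
Qed.

(** Forgetting the split is locally injective, because the two halves of a vertex have disjoint
    neighbourhoods. Degree at least 2D beforehand leaves D for each half. *)
Lemma split_vertices (r : nat) (W : finType) (f : rel W) (D Delta N : nat) :
  0 < r -> symmetric f -> biclique_free r f ->
  (forall w, D.*2 <= degree f w <= Delta) ->
  #|W| <= N <= #|W|.*2 ->
  exists (A : finType) (e : rel A),
    [/\ #|A| = N, symmetric e, biclique_free r e &
        forall a, D <= degree e a <= Delta].
Proof.
move=> r0 fsym free_f degf /andP[WN NW].
have [S _ cardS] : exists2 S : {set W}, S \subset setT & #|S| = N - #|W|.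
  by apply: exists_subset_card; rewrite cardsT; lia.
have exP w : exists B : {set W}, (B \subset [set y | f w y]) && (#|B| == D).
  have [|B BA <-] := @exists_subset_card W [set y | f w y] D; last by exists B; rewrite BA eqxx.
  by have := degf w; rewrite /degree; lia.
pose P w := xchoose (exP w).
have Psub w : P w \subset [set y | f w y] by have /andP[] := xchooseP (exP w).
have Pcard w : #|P w| = D by have /andP[_ /eqP] := xchooseP (exP w).
(* [(w, false)] is always a vertex and [(w, true)] only for [w] in [S], which gives
   [#|W| + #|S| = N] vertices. *)
pose isA (p : W * bool) := p.2 ==> (p.1 \in S).
pose A := {p | isA p}.
pose lab (a : A) := (val a).1.
(* A vertex of [S] is split into two, receiving [P w] and the remaining neighbours. *)
pose ok (a : A) u := (lab a \in S) ==> ((val a).2 == (u \in P (lab a))).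
pose e (a b : A) := [&& f (lab a) (lab b), ok a (lab b) & ok b (lab a)].
have esym : symmetric e.
  by move=> a b; rewrite /e fsym; congr andb; rewrite andbC.
have loc_inj a a' b : e a b -> e a' b -> lab a = lab a' -> a = a'.
  move=> /and3P[_ oka _] /and3P[_ oka' _] labE; apply: val_inj.
  move: oka oka'; rewrite /ok -labE => oka oka'; move: labE oka oka'.
  case: a => [[w s] /= ws]; case: a' => [[w' s'] /= ws'].
  rewrite /lab /= => ww'; subst w'; move: ws ws'; rewrite /isA /=.
  by case: (w \in S) => /=; [move=> _ _ /eqP -> /eqP ->|case: s; case: s'].
exists A, e; split=> //.
- rewrite card_sig.
  have -> : #|[pred x | isA x]| = #|[set (w, false) | w in W] :|: [set (w, true) | w in S]|.
    apply: eq_card => -[w s]; rewrite !inE /isA /=; apply/implyP/orP.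
      by case: s => H; [right|left]; apply/imsetP; exists w => //; exact: H.
    by case=> /imsetP[w' w'S [-> ->]].
  rewrite cardsU !card_imset; try by move=> ? ? [].
  rewrite cardS (_ : _ :&: _ = set0) ?cards0; last first.
    apply/setP=> p; rewrite !inE; apply/andP => -[/imsetP[w _ ->] /imsetP[w' _ []]] //.
  by rewrite subn0 subnKC.
- by apply: (@biclique_free_pullback _ _ _ e f lab) => // a b /and3P[].
- move=> a.
  (* Each admissible label [u] has exactly one copy that accepts [a], so splitting the neighbours of
     [a] does not change its degree. *)
  have -> : degree e a = #|[set u | f (lab a) u && ok a u]|.
    rewrite /degree -(card_in_imset (f := lab)).
      apply: eq_card => u; rewrite !inE; apply/imsetP/andP.
        by move=> [b]; rewrite inE => /and3P[? ? ?] ->.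
      move=> [fau oka].
      have isAb : isA (u, (u \in S) && (lab a \in P u)) by apply/implyP => /andP[].
      exists (exist (fun p => isA p) _ isAb : A) => //; rewrite inE /e fau oka /= /ok /lab /=.
      by case: (u \in S) => /=; rewrite ?eqxx.
    by move=> b b'; rewrite !inE ![e a _]esym; exact: loc_inj.
  have := degf (lab a); rewrite /degree => /andP[d1 d2]; apply/andP; split; last first.
    by apply: leq_trans d2; apply: subset_leq_card; apply/subsetP=> u; rewrite !inE => /andP[].
  have [aS|aS] := boolP (lab a \in S); last first.
    apply: (@leq_trans D.*2); first by lia.
    apply: leq_trans d1 _; apply: subset_leq_card; apply/subsetP=> u.
    by rewrite !inE /ok (negbTE aS) /= andbT.
  (* The half marked [true] receives [P], of size D; the other receives the rest, at least 2D -
     D. *)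
  case sE: ((val a).2).
    rewrite -(Pcard (lab a)); apply: subset_leq_card; apply/subsetP=> u uP.
    by have /subsetP/(_ u uP) := Psub (lab a); rewrite !inE /ok aS sE uP => ->.
  have := cardsID (P (lab a)) [set u | f (lab a) u].
  rewrite (setIidPr (Psub _)) Pcard => cE.
  have : #|[set u | f (lab a) u] :\: P (lab a)| <= #|[set u | f (lab a) u && ok a u]|.
    apply: subset_leq_card; apply/subsetP=> u.
    by rewrite !inE /ok aS sE => /andP[/negbTE -> ->].
  by lia.
Qed.

(** * Dense subgraphs and minimum degree *)

Definition arcs_in (V : finType) (e : rel V) (W : {set V}) : {set V * V} :=
  [set p | [&& p.1 \in W, p.2 \in W & e p.1 p.2]].

(** Take [W] inclusion-minimal with more than [l * #|W|] arcs: deleting a vertex of degree at most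
    l/2 loses at most l arcs, since an edge counts in both directions, and this contradicts
    minimality. *)
Lemma min_degree_subset (V : finType) (e : rel V) (U : {set V}) (l : nat) :
  symmetric e -> l * #|U| < #|arcs_in e U| ->
  exists W : {set V}, [/\ W \subset U, 0 < #|W| &
    forall w, w \in W -> l < #|[set u in W | e w u]|.*2].
Proof.
move=> esym HU.
have [W /minsetP[PW minW] WU] := @minset_exists _ (fun W => l * #|W| < #|arcs_in e W|) U HU.
exists W; split=> //.
  rewrite lt0n; apply/eqP => W0; move: PW; rewrite W0 muln0 card_gt0.
  move/set0Pn => [p]; rewrite inE => /and3P[pW _ _].
  by move/eqP: W0; rewrite cards_eq0 => /eqP W0; rewrite W0 inE in pW.
move=> w wW; rewrite ltnNge; apply/negP=> degw.
have WwE := cardsD1 w W; rewrite wW /= in WwE.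
have sub : arcs_in e W \subset arcs_in e (W :\ w) :|:
    (setX [set w] [set u in W | e w u] :|: setX [set u in W | e w u] [set w]).
  apply/subsetP => -[x y]; rewrite !inE /= => /and3P[xW yW exy]; rewrite xW yW exy /=.
  have [xw|xw] /= := eqVneq x w; first by rewrite -xw exy ?orbT.
  have [yw|yw] /= := eqVneq y w; last by [].
  by rewrite -yw esym exy ?orbT.
have le_arcs : #|arcs_in e W| <= #|arcs_in e (W :\ w)| + l.
  apply: leq_trans (subset_leq_card sub) (leq_trans (leq_card_setU _ _) _).
  rewrite leq_add2l; apply: leq_trans degw; apply: leq_trans (leq_card_setU _ _) _.
  by rewrite !cardsX !cards1 mul1n muln1 addnn.
have : l * #|W :\ w| < #|arcs_in e (W :\ w)|.
  rewrite -(ltn_add2r l) (leq_trans _ le_arcs) //.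
  by rewrite (_ : l * _ + l = l * #|W|) // WwE mulnDr muln1 addnC.
move=> /minW /(_ (subD1set _ _)) /setP /(_ w).
by rewrite !inE eqxx wW.
Qed.

(** Pigeonhole over the 256 pairs of residue classes mod 16: every arc lies in the union of the
    classes of its two ends. *)
Lemma dense_small_subset (n : nat) (e : rel 'I_n) :
  exists U : {set 'I_n}, #|U| <= (n %/ 16).+1.*2 /\
    #|arcs_in e setT| <= 256 * #|arcs_in e U|.
Proof.
pose U (c : 'I_16 * 'I_16) := [set x : 'I_n | (x %% 16 == c.1) || (x %% 16 == c.2)].
pose cl (i : nat) := [set x : 'I_n | x %% 16 == i].
have card_cl i : #|cl i| <= (n %/ 16).+1.
  pose h (x : 'I_n) : 'I_(n %/ 16).+1 := inord (x %/ 16).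
  rewrite -(card_ord (n %/ 16).+1) -(card_in_imset (f := h)) ?max_card //.
  move=> x y; rewrite !inE => /eqP xi /eqP yi /(congr1 val).
  have := ltn_ord x; have := ltn_ord y => ? ?.
  rewrite /= !inordK ?ltnS ?leq_div2r //; try exact: ltnW.
  move=> E; apply: val_inj => /=; by rewrite (divn_eq x 16) (divn_eq y 16) E xi yi.
have card_U c : #|U c| <= (n %/ 16).+1.*2.
  have -> : U c = cl c.1 :|: cl c.2 by apply/setP=> x; rewrite !inE.
  apply: leq_trans (leq_card_setU _ _) _.
  by have := card_cl c.1; have := card_cl c.2; lia.
pose c0 : 'I_16 * 'I_16 := (ord0, ord0).
pose c := [arg max_(c > c0) #|arcs_in e (U c)|].
exists (U c); split; first exact: card_U.
have cmax c' : #|arcs_in e (U c')| <= #|arcs_in e (U c)|.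
  by rewrite /c; case: arg_maxnP => // i _; apply.
have cover_arcs : arcs_in e setT \subset \bigcup_(c' : 'I_16 * 'I_16) arcs_in e (U c').
  apply/subsetP=> -[x y]; rewrite !inE /= => exy.
  apply/bigcupP; exists (inord (x %% 16), inord (y %% 16)) => //.
  by rewrite !inE /= !inordK ?ltn_mod // !eqxx exy orbT.
apply: leq_trans (subset_leq_card cover_arcs) _.
apply: (@leq_trans (\sum_(c' : 'I_16 * 'I_16) #|arcs_in e (U c')|)).
  elim/big_rec2: _ => [|c' k X _ IH]; first by rewrite cards0.
  by apply: leq_trans (leq_card_setU _ _) _; rewrite leq_add2l.
apply: leq_trans (leq_sum _ (fun i _ => cmax i)) _.
by rewrite sum_nat_const card_prod !card_ord.
Qed.

(** * The tournament and its semidegree *)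

Lemma exists_regular_tournament (A : finType) (m : nat) :
  #|A| = m.*2.+1 ->
  exists R : rel A, is_tournament R /\
    forall x, outdeg R x = m /\ indeg R x = m.
Proof.
move=> cardA.
pose h (x : A) : 'I_m.*2.+1 := cast_ord cardA (enum_rank x).
have hinj : injective h by move=> x y /cast_ord_inj /enum_rank_inj.
have hsurj z : exists x, h x = z.
  by exists (enum_val (cast_ord (esym cardA) z)); rewrite /h enum_valK cast_ordKV.
(* Circulant tournament on the integers mod 2m + 1 with connection set {1, ..., m}. *)
pose S := [set z : 'I_m.*2.+1 | 0 < z <= m].
pose R x y := (h y - h x)%R \in S.
have subE (x y : 'I_m.*2.+1) : (x - y)%R = (x + (m.*2.+1 - y)) %% m.*2.+1 :> nat.
  by rewrite /= modnDmr.
(* Opposite differences sum to 2m + 1, so exactly one of them lies in [S]. *)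
have subN (x y : 'I_m.*2.+1) : x < y -> (x - y)%R + (y - x)%R = m.*2.+1 :> nat.
  have := ltn_ord y; rewrite !subE => yn xy.
  have -> : y + (m.*2.+1 - x) = y - x + m.*2.+1 by lia.
  by rewrite modnDr !modn_small; lia.
have tourR : is_tournament R.
  split=> [x|x y xy]; first by rewrite /R subrr inE.
  have {xy} : (h x - h y)%R + (h y - h x)%R = m.*2.+1 :> nat.
    have [/subN//|/subN|/val_inj/hinj/eqP] := ltngtP (h x) (h y); last by rewrite (negbTE xy).
    by rewrite addnC.
  by rewrite /R !inE; move: (h x - h y)%R (h y - h x)%R => u w; have := ltn_ord u; have := ltn_ord w; lia.
have cardS : #|S| = m.
  rewrite -[RHS]card_ord -(card_imset _ (f := fun i : 'I_m => inord i.+1 : 'I_m.*2.+1)).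
    apply: eq_card => z; rewrite inE; apply/idP/imsetP => [zm|[i _ ->]].
      have zm' : z.-1 < m by lia.
      by exists (Ordinal zm') => //; apply: val_inj; rewrite /= inordK; lia.
    by have ? := ltn_ord i; rewrite inordK; lia.
  move=> i j /(congr1 val); have := ltn_ord i; have := ltn_ord j => ? ?.
  by rewrite /= !inordK; try lia; move=> [/val_inj].
exists R; split=> // x; split; rewrite -[RHS]cardS.
  rewrite /outdeg -(card_imset _ (f := fun y => h y - h x)%R); last first.
    by move=> y y' /addIr /hinj.
  apply: eq_card => z; apply/imsetP/idP => [[y]|zS]; first by rewrite inE => H ->.
  by have [y hy] := hsurj (z + h x)%R; exists y; rewrite ?inE /R hy addrK.
rewrite /indeg -(card_imset _ (f := fun y => h x - h y)%R); last first.
  by move=> y y' /addrI /oppr_inj /hinj.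
apply: eq_card => z; apply/imsetP/idP => [[y]|zS]; first by rewrite inE => H ->.
by have [y hy] := hsurj (h x - z)%R; exists y; rewrite ?inE /R hy subKr.
Qed.

Lemma card_set_sum (A B : finType) (P : pred (A + B)) :
  #|[set y | P y]| = #|[set a | P (inl a)]| + #|[set b | P (inr b)]|.
Proof.
by rewrite -!sum1_card !(big_mkcond (fun _ => _ \in _)) big_sumType /=;
  congr addn; apply: eq_bigr => x _; rewrite !inE.
Qed.

Lemma bigmin_geq (I : finType) (F : I -> nat) (m x : nat) :
  m <= x -> (forall i, m <= F i) -> m <= \big[minn/x]_i F i.
Proof.
move=> mx mF; elim/big_ind: _ => // a b ma mb.
by rewrite leq_min ma.
Qed.

(* [H] is symmetric in all uses: it is the bipartite double cover of a graph. *)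
Definition tournament_of (A : finType) (R H : rel A) (x y : (A + A) + unit) : bool :=
  match x, y with
  | inl (inl a), inl (inl a') => R a a'
  | inl (inl a), inl (inr b) => ~~ H a b
  | inl (inr b), inl (inl a) => H a b
  | inl (inr b), inl (inr b') => R b b'
  | inl (inr _), inr _ => true
  | inr _, inl (inl _) => true
  | _, _ => false
  end.

Lemma tournament_ofP (A : finType) (R H : rel A) :
  is_tournament R -> is_tournament (tournament_of R H).
Proof.
move=> [irrR totR]; split; first by case=> [[a|b]|[]] //=.
case=> [[a|b]|[]] [[a'|b']|[]] //= xy; try by case: (H _ _).
- by apply: totR; apply: contraNneq xy => ->.
- by apply: totR; apply: contraNneq xy => ->.
Qed.

(** If d is the degree in [H], a vertex of the first part has in-degree m + d + 1 and out-degree m +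
    (2m + 1 - d); in the second part the two are exchanged. The two bounds on d control these two
    values. *)
Lemma tournament_of_semidegree (A : finType) (R H : rel A) (m D : nat) :
  #|A| = m.*2.+1 -> symmetric H ->
  (forall x, outdeg R x = m /\ indeg R x = m) ->
  (forall x, D <= degree H x /\ degree H x + D < #|A|) ->
  m.+1 + D <= min_semidegree (tournament_of R H).
Proof.
move=> cardA symH regR degH.
have degC x : #|[set y | ~~ H x y]| + degree H x = m.*2.+1.
  rewrite -cardA /degree -(cardC [set y | H x y]) addnC; congr addn.
  by apply: eq_card => y; rewrite !inE.
have symS x : [set y | H y x] = [set y | H x y] by apply/setP=> y; rewrite !inE symH.
have symN x : [set y | ~~ H y x] = [set y | ~~ H x y] by apply/setP=> y; rewrite !inE symH.
have cT : #|[set _ : A | true]| = m.*2.+1 by rewrite -cardA cardsE.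
have cF : #|[set _ : A | false]| = 0 by apply: eq_card0 => y; rewrite inE.
have cT1 : #|[set _ : unit | true]| = 1 by rewrite -card_unit cardsE.
have cF1 : #|[set _ : unit | false]| = 0 by apply: eq_card0 => y; rewrite inE.
(* From 2D <= d + D < 2m + 1; the extra vertex, with both degrees 2m + 1, needs this. *)
have Dm : D <= m.
  have /card_gt0P[x _] : 0 < #|A| by rewrite cardA.
  by have [] := degH x; rewrite cardA; lia.
apply: bigmin_geq; first by rewrite !card_sum card_unit cardA; lia.
move=> x; rewrite leq_min /indeg /outdeg !card_set_sum.
case: x => [[a|b]|[]] /=; rewrite ?symS ?symN ?cT ?cF ?cT1 ?cF1; last by lia.
- have [] := regR a; have [] := degH a; have := degC a; rewrite /outdeg /indeg /degree cardA.
  by do 4!move: #|pred_of_set _|; clear; lia.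
- have [] := regR b; have [] := degH b; have := degC b; rewrite /outdeg /indeg /degree cardA.
  by do 4!move: #|pred_of_set _|; clear; lia.
Qed.

(** * Absence of the Hamilton cycle power *)

Lemma tournament_of_not_hamilton (A : finType) (R H : rel A) (k r : nat) :
  0 < r -> r.*2 <= k -> r <= #|A| -> biclique_free r H ->
  ~ has_hamilton_cycle_power k (tournament_of R H).
Proof.
move=> r0 rk rA freeH [v [[w vK wK] cyc]].
set n := #|_| in v w vK wK cyc.
have rn : r < n by rewrite /n !card_sum card_unit; lia.
pose p := w (inr tt).
have n0 : 0 < n by lia.
have pn : p < n := ltn_ord p.
(* Adding [n] keeps the subtraction from truncating; [rn] makes the [r] positions on either side of
   [p] distinct. *)
have before_lt (i : 'I_r) : (p + n - i.+1) %% n < n by rewrite ltn_mod.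
have after_lt (i : 'I_r) : (p + i.+1) %% n < n by rewrite ltn_mod.
pose before i := Ordinal (before_lt i); pose after i := Ordinal (after_lt i).
have power (a b : 'I_n) j : j < k -> b = (a + j.+1) %% n :> nat ->
    tournament_of R H (v a) (v b).
  by move=> jk bE; apply: cyc; apply/existsP; exists (Ordinal jk); rewrite bE.
have vp : v p = inr tt by rewrite /p wK.
have beforeP i : exists b, v (before i) = inl (inr b).
  have := @power (before i) p i; rewrite vp.
  have -> : (before i + i.+1) %% n = p.
    by rewrite /= modnDml subnK ?modnDr ?modn_small //; have := ltn_ord i; lia.
  move=> /(_ _ erefl); case: (v (before i)) => [[a|b]|[]] /=; last 1 first.
  - by move=> H0; have : false by apply: H0; have := ltn_ord i; lia.
  - by move=> H0; have : false by apply: H0; have := ltn_ord i; lia.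
  - by exists b.
have afterP i : exists a, v (after i) = inl (inl a).
  have := @power p (after i) i; rewrite vp => /(_ _ erefl).
  case: (v (after i)) => [[a|b]|[]] /=; last 1 first.
  - by move=> H0; have : false by apply: H0; have := ltn_ord i; lia.
  - by exists a.
  - by move=> H0; have : false by apply: H0; have := ltn_ord i; lia.
have [bs bsE] := fin_all_exists beforeP.
have [al alE] := fin_all_exists afterP.
have vinj : injective v := can_inj vK.
have before_inj : injective before.
  move=> i j /(congr1 val) /eqP /=; have ? := ltn_ord i; have ? := ltn_ord j.
  rewrite -!addnBA ?eqn_modDl ?modn_small; try lia.
  by move=> /eqP E; apply: val_inj => /=; lia.
have after_inj : injective after.
  move=> i j /(congr1 val) /eqP /=; have ? := ltn_ord i; have ? := ltn_ord j.
  rewrite eqn_modDl !modn_small; try lia.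
  by move=> /eqP E; apply: val_inj => /=; lia.
apply: (freeH al bs) => [i j Eij|i j Eij|i j].
- by apply: after_inj; apply: vinj; rewrite !alE Eij.
- by apply: before_inj; apply: vinj; rewrite !bsE Eij.
(* The distance along the cycle is i + j + 2 <= 2r <= k, and an arc from the second part to the
   first is an edge of [H]. *)
- have := @power (before j) (after i) (i + j).+1; rewrite bsE alE /=; apply.
    by have := ltn_ord i; have := ltn_ord j; lia.
  rewrite modnDml; have -> : p + n - j.+1 + (i + j).+2 = p + i.+1 + n.
    by have := ltn_ord i; have := ltn_ord j; lia.
  by rewrite modnDr.
Qed.

(** * Extremal graphs and the backward graph *)

Lemma graph_adj_sym (V : finType) (E : {set {set V}}) :
  symmetric (fun x y : V => [set x; y] \in E).
Proof. by move=> x y /=; rewrite [[set x; y]]setUC. Qed.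

Lemma biclique_free_graph (r : nat) (V : finType) (E : {set {set V}}) :
  is_graph E -> ~~ contains_copy (complete_bipartite r r) E ->
  biclique_free r (fun x y : V => [set x; y] \in E).
Proof.
move=> /forall_inP graphE /existsP noK x y inj_x inj_y xyE; apply: noK.
pose g (u : 'I_r + 'I_r) := match u with inl i => x i | inr j => y j end.
exists (finfun g); apply/andP; split.
  (* An edge has two elements, so the two sides are automatically disjoint. *)
  have xy i j : x i <> y j.
    by move=> eq_xy; have := graphE _ (xyE i j); rewrite eq_xy setUid cards1.
  apply/injectiveP => -[i|i] [j|j]; rewrite !ffunE /=.
  - by move/inj_x ->.
  - by move/xy.
  - by move/esym/xy.
  - by move/inj_y ->.
apply/forall_inP => F /imset2P[i j _ _ ->].
by rewrite imsetU !imset_set1 !ffunE; exact: xyE.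
Qed.

Lemma card_graph_arcs (V : finType) (E : {set {set V}}) :
  is_graph E ->
  #|E| <= #|arcs_in (fun x y : V => [set x; y] \in E) setT|.
Proof.
move=> /forall_inP graphE.
apply: leq_trans (leq_imset_card (fun p : V * V => [set p.1; p.2]) _).
apply: subset_leq_card; apply/subsetP => F FE.
have /cards2P[x [y [_ FxyE]]] := graphE _ FE.
by apply/imsetP; exists (x, y) => //; rewrite !inE -FxyE.
Qed.

Lemma ex_number_witness (n : nat) (U : finType) (F : {set {set U}}) :
  0 < ex_number n F ->
  exists E : {set {set 'I_n}},
    [/\ is_graph E, ~~ contains_copy F E & #|E| = ex_number n F].
Proof.
rewrite /ex_number => ex0.
pose P := [pred E : {set {set 'I_n}} | is_graph E && ~~ contains_copy F E].
(* An empty maximum would be 0, against [ex0]. *)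
have [P0|P0] := posnP #|P|.
  by move: ex0; rewrite big_pred0 // => E; have := card0_eq P0 E; rewrite inE.
have [E /andP[gE cE] ->] := eq_bigmax_cond (fun E : {set {set 'I_n}} => #|E|) P0.
by exists E; split.
Qed.

(* When 0 < ex < 512 n the quotient [ex %/ (512 * n)] vanishes, and [H] is a
   perfect matching. *)
Lemma exists_backward_graph (n m r : nat) :
  0 < r -> n = 4 * m + 3 -> 64 <= n ->
  exists (D : nat) (A : finType) (H : rel A),
    [/\ #|A| = m.*2.+1, symmetric H, biclique_free r H,
        (forall x, D <= degree H x /\ degree H x + D < #|A|) &
        ex_number n (complete_bipartite r r) <= 1024 * n * D].
Proof.
move=> r0 nE n64; set ex := ex_number _ _.
have [ex0|ex_gt0] := posnP ex.
  exists 0, 'I_m.*2.+1, (fun _ _ => false); split=> //; first by rewrite card_ord.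
  - by move=> x y _ _ /(_ (Ordinal r0) (Ordinal r0)).
  - by move=> x; rewrite /degree eq_card0 ?card_ord // => y; rewrite inE.
  - by rewrite ex0.
have [E [graphE freeE cardE]] := ex_number_witness ex_gt0.
set G : rel 'I_n := fun x y => [set x; y] \in E.
have freeG : biclique_free r G := biclique_free_graph graphE freeE.
have symG : symmetric G := @graph_adj_sym _ E.
(* 512 = 2 * 256: restricting to [U] costs a factor 256, leaving at least 2nD arcs, strictly more
   than nD >= 4D [#|U|]. *)
pose D := ex %/ (512 * n).
have [D0|Dgt0] := posnP D.
  (* A single edge is a K_{1,1}, so [0 < ex] forces r >= 2, and a perfect matching is then
     biclique-free. *)
  have r2 : 1 < r.
    rewrite ltnNge; apply/negP=> r1; have /eqP {}r1 : r == 1 by lia.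
    have /card_gt0P[F FE] : 0 < #|E| by rewrite cardE.
    have /forall_inP/(_ _ FE)/cards2P[x [y [_ FxyE]]] := graphE; subst r.
    apply: (freeG (fun=> x) (fun=> y)); try by move=> i j _; rewrite !ord1.
    by rewrite /G -FxyE.
  exists 1, 'I_m.*2.+1, (fun x y => x == y); split=> //.
  - by rewrite card_ord.
  - move=> x y inj_x _ xy.
    have /inj_x // : x (Ordinal r0) = x (Ordinal r2).
    by rewrite (eqP (xy _ (Ordinal r0))) (eqP (xy (Ordinal r2) (Ordinal r0))).
  - move=> x; have -> : degree (fun x y : 'I_m.*2.+1 => x == y) x = 1.
      by rewrite /degree -(card1 x); apply: eq_card => y; rewrite !inE eq_sym.
    by rewrite card_ord; lia.
  - by have := @ltn_ceil ex (512 * n) ltac:(lia); rewrite -/D D0; lia.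
have exD : 512 * n * D <= ex by rewrite mulnC leq_trunc_div.
have exD' : ex <= 1024 * n * D.
  have := @ltn_ceil ex (512 * n) ltac:(lia); rewrite -/D; nia.
have [U [cardU arcsU]] := dense_small_subset G.
(* The constant 4 gives degrees above 2D, as the later splitting halves them. *)
have [W [WU W0 degW]] : exists W : {set 'I_n}, [/\ W \subset U, 0 < #|W| &
    forall w, w \in W -> 4 * D < #|[set u in W | G w u]|.*2].
  apply: min_degree_subset => //.
  have := card_graph_arcs graphE; rewrite cardE -/ex -/G => exG.
  have Un : 4 * #|U| <= n by move: cardU; move: #|U|; clear -n64; lia.
  have Dn : 0 < n * D by rewrite muln_gt0 Dgt0; lia.
  have DU : 4 * D * #|U| <= n * D by rewrite mulnAC leq_mul2r Un orbT.
  move: (leq_trans exD (leq_trans exG arcsU)) DU Dn; rewrite -mulnA.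
  by move: (4 * D * _) #|arcs_in _ _| (n * D); clear; lia.
have cardW : #|W| <= (n %/ 16).+1.*2 := leq_trans (subset_leq_card WU) cardU.
pose W' := {x | x \in W}.
pose G' (x y : W') := G (val x) (val y).
have symG' : symmetric G' by move=> x y; exact: symG.
have freeG' : biclique_free r G'.
  by apply: (@biclique_free_pullback _ _ _ G' G val) => // a a' b _ _ /val_inj.
have degG' w : D.*2 <= degree G' w <= #|W|.
  have -> : degree G' w = #|[set u in W | G (val w) u]|.
    rewrite /degree -(card_imset _ val_inj); apply: eq_card => u; rewrite !inE.
    apply/imsetP/andP => [[u']|[uW Gu]].
      by rewrite inE => Gu ->; split=> //; exact: (valP u').
    by exists (exist (fun x => x \in W) u uW); rewrite ?inE.
  have := degW _ (valP w).
  have : #|[set u in W | G (val w) u]| <= #|W|.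
    by apply: subset_leq_card; apply/subsetP=> u; rewrite inE => /andP[].
  by move: #|[set u in W | _]| #|W|; clear; lia.
have [e [symE freeE' degE]] := disjoint_copies (m.*2.+1 %/ #|W|) r0 symG' freeG'.
have degE' p : D.*2 <= degree e p <= #|W| by rewrite degE.
(* With q >= 1 the quotient, q [#|W|] <= 2m + 1 < (q + 1) [#|W|] <= 2q [#|W|], the range that
   splitting can reach. *)
have sizes : #|{: W' * 'I_(m.*2.+1 %/ #|W|)}| <= m.*2.+1
    <= #|{: W' * 'I_(m.*2.+1 %/ #|W|)}|.*2.
  rewrite card_prod card_sig card_ord (_ : #|_| = #|W|); last exact: eq_card.
  have Wm : #|W| <= m.*2.+1 by move: cardW; move: #|W|; clear -nE n64; lia.
  rewrite mulnC leq_trunc_div /=.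
  have := divn_gt0 m.*2.+1 W0; rewrite Wm; have := ltn_ceil m.*2.+1 W0.
  by move: #|W| (m.*2.+1) => q N; move: (N %/ q); clear; nia.
have [A [H [cardA symH freeH degH]]] := split_vertices r0 symE freeE' degE' sizes.
exists D, A, H; split=> // x.
(* Both D and the degree are at most [#|W|], about n/8, so their sum stays below 2m + 1, about
   n/2. *)
have /andP[DH HW] := degH x; split=> //; rewrite cardA.
by move: (degree H x) #|W| cardW DH HW; clear -nE n64; lia.
Qed.

(** * Choice of constants and conclusion *)

Local Open Scope ring_scope.

(* uphalf (k - 1) = ceil((k - 1) / 2) *)
Theorem theorem1p3 (R : realType) (k r : nat) (hk : (2 <= k)%N)
    (hr : r = uphalf (k - 1)) :
  exists c : R, 0 < c /\
    exists N : nat, forall n : nat, (N <= n)%N -> n = 3 %[mod 4] ->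
      exists (V : finType) (T : rel V),
        [/\ #|V| = n,
            is_tournament T,
            (n%:R + 1) / 4%:R
              + c * ((ex_number n (complete_bipartite r r))%:R / n%:R)
              <= (min_semidegree T)%:R :> R
          & ~ has_hamilton_cycle_power k T].
Proof.
exists (1024%:R^-1); split; first by rewrite invr_gt0 ltr0n.
(* 64 serves the construction of [H]; 4r ensures [r <= #|A|]. *)
exists (64 + 4 * r)%N => n nN n3.
have r0 : (0 < r)%N by rewrite hr; lia.
have rk : (r.*2 <= k)%N by rewrite hr; lia.
pose m := (n %/ 4)%N.
have nE : n = (4 * m + 3)%N by rewrite {1}(divn_eq n 4) n3 mulnC.
have n64 : (64 <= n)%N by lia.
have [D [A [H [cardA symH freeH degH exD]]]] := exists_backward_graph r0 nE n64.
have [S [tourS regS]] := exists_regular_tournament cardA.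
exists ((A + A) + unit)%type, (tournament_of S H); split.
- by rewrite !card_sum card_unit cardA; lia.
- exact: tournament_ofP.
- apply: (@le_trans _ _ (m.+1 + D)%N%:R); last first.
    by rewrite ler_nat; exact: tournament_of_semidegree.
  (* (n + 1)/4 is exactly m + 1, so only ex / (1024 n) <= D remains. *)
  have -> : n%:R + 1 = 4%:R * m.+1%:R :> R.
    by rewrite -natrM -[1]/(1%:R) -natrD; congr _%:R; lia.
  rewrite mulrC mulKf ?pnatr_eq0 // natrD lerD2l.
  have n_gt0 : 0 < n%:R :> R by rewrite ltr0n; lia.
  rewrite ler_pdivrMl ?ltr0n // ler_pdivrMr // -!natrM ler_nat.
  by rewrite mulnAC.
- by apply: (@tournament_of_not_hamilton _ _ _ _ r) => //; lia.
Qed.
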